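(* Let $K$ and $L$ be compact Hausdorff topological spaces. (a) Suppose that $K$ and $L$ do not contain isolated points. Then every isometric isomorphism $T$ from $(C(K),\|\cdot\|_d)$ onto $(C(L),\|\cdot\|_d)$ has the form $$T(x)=\pm\,x\circ\varphi$$ for some homeomorphism $\varphi\colon L\to K$. (b) Suppose that either $K$ or $L$ contains an isolated point. Let $T\colon(C(K),\|\cdot\|_d)\to(C(L),\|\cdot\|_d)$ be an isometric isomorphism. Then $T$ is one of the following types. (i) $T(x)=\pm\,x\circ\varphi$ for some homeomorphism $\varphi\colon L\to K$. (ii) There exist $p$ in $K$ and $t$ in $L$ and a homeomorphism $\varphi\colon L\setminus\{t\}\to K\setminus\{p\}$ such that $T=\pm T_1$, where $$(T_1x)(t)=x(p),\qquad (T_1x)(s)=x(p)-x(\varphi(s))\quad\text{for } s\ne t.$$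
   Context: For a compact Hausdorff space $K$, $C(K)$ is the space of continuous real functions on $K$, with the norm $\|x\|_d=\|x^+\|_\infty+\|x^-\|_\infty=\max\{\|x\|_\infty,\sup_{s,t\in K}|x(s)-x(t)|\}$, where $\|x\|_\infty=\sup_{t\in K}|x(t)|$ and $x^\pm$ are the positive and negative parts of $x$. An isometric isomorphism is a surjective linear isometry. The sign $\pm$ is a single global choice depending on $T$ only. *)

(* Defs.v *)
From HB Require Import structures.
From mathcomp Require Import all_boot all_order all_algebra.
From mathcomp Require Import all_classical all_reals all_analysis.

Set Implicit Arguments.
Unset Strict Implicit.
Unset Printing Implicit Defensive.

Import Order.TTheory GRing.Theory Num.Theory.
Import numFieldNormedType.Exports.
Local Open Scope classical_set_scope.
Local Open Scope ring_scope.

(* C(K) is the type [continuousType K R], with pointwise operations. *)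
Section ContinuousFunctions.
Context {R : realType} {K : topologicalType}.
Implicit Types f g h : continuousType K R.

Fact cts_zero_subproof : continuous (fun _ : K => 0 : R).
Proof. by move=> t; exact: cvg_cst. Qed.

Fact cts_opp_subproof f : continuous (fun t => - f t).
Proof. by move=> t; apply: cvgN; exact: cts_fun. Qed.

Fact cts_add_subproof f g : continuous (fun t => f t + g t).
Proof. by move=> t; apply: cvgD; exact: cts_fun. Qed.

Fact cts_scale_subproof (a : R) f : continuous (fun t => a * f t).
Proof. by move=> t; apply: cvgMr; exact: cts_fun. Qed.

Definition cts_zero : continuousType K R := mkcts cts_zero_subproof.
Definition cts_opp f : continuousType K R := mkcts (cts_opp_subproof (f := f)).
Definition cts_add f g : continuousType K R :=
  mkcts (cts_add_subproof (f := f) (g := g)).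
Definition cts_scale (a : R) f : continuousType K R :=
  mkcts (cts_scale_subproof (a := a) (f := f)).

Fact cts_addA : associative cts_add.
Proof. by move=> f g h; apply/continuousEP => t; exact: addrA. Qed.

Fact cts_addC : commutative cts_add.
Proof. by move=> f g; apply/continuousEP => t; exact: addrC. Qed.

Fact cts_add0 : left_id cts_zero cts_add.
Proof. by move=> f; apply/continuousEP => t; exact: add0r. Qed.

Fact cts_addN : left_inverse cts_zero cts_opp cts_add.
Proof. by move=> f; apply/continuousEP => t; exact: addNr. Qed.

HB.instance Definition _ :=
  GRing.isZmodule.Build (continuousType K R) cts_addA cts_addC cts_add0 cts_addN.

Fact cts_scaleA (a b : R) f : cts_scale a (cts_scale b f) = cts_scale (a * b) f.
Proof. by apply/continuousEP => t; exact: mulrA. Qed.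

Fact cts_scale1 : left_id 1 cts_scale.
Proof. by move=> f; apply/continuousEP => t; exact: mul1r. Qed.

Fact cts_scaleDr : right_distributive cts_scale +%R.
Proof. by move=> a f g; apply/continuousEP => t; exact: mulrDr. Qed.

Fact cts_scaleDl f : {morph cts_scale^~ f : a b / a + b}.
Proof. by move=> a b; apply/continuousEP => t; exact: mulrDl. Qed.

HB.instance Definition _ :=
  GRing.Zmodule_isLmodule.Build R (continuousType K R)
    cts_scaleA cts_scale1 cts_scaleDr cts_scaleDl.

End ContinuousFunctions.

Section DiameterNorm.
Context {R : realType} {K : topologicalType}.

(* [sup set0 = 0] in the library, so that the norm is 0 when [K] is empty. *)
Definition supnorm (x : K -> R) : R := sup (range (fun t => `|x t|)).

Definition dnorm (x : continuousType K R) : R := supnorm x^\+ + supnorm x^\-.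

End DiameterNorm.

Definition isometric_isomorphism {R : realType} {K L : topologicalType}
    (T : {linear continuousType K R -> continuousType L R}) :=
  (forall y, exists x, T x = y) /\ (forall x, dnorm (T x) = dnorm x).

Definition homeomorphism {X Y : topologicalType} (f : X -> Y) :=
  continuous f /\
  exists g : Y -> X, [/\ cancel f g, cancel g f & continuous g].

(* Main.v *)
Require Import Defs.
From HB Require Import structures.
From mathcomp Require Import all_boot all_order all_algebra.
From mathcomp Require Import all_classical all_reals all_analysis.
From mathcomp Require Import ring lra.

Set Implicit Arguments.
Unset Strict Implicit.
Unset Printing Implicit Defensive.

Import Order.TTheory GRing.Theory Num.Theory.
Import numFieldNormedType.Exports.
Local Open Scope classical_set_scope.
Local Open Scope ring_scope.

(** Add to [K] an isolated point [None] and extend every [x] in C(K) by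
    [ext x None = 0].  Then the norm of [x] is the oscillation
    [max (ext x) - min (ext x)] over [K + None], so that C(K) with the
    diameter norm is the space of continuous functions on the compact
    Hausdorff space [K + None], modulo constants, with the oscillation norm.
    All points of [K + None] now play the same part, and the theorem says that
    an isometry comes, up to a sign, from a homeomorphism [phi] of [L + None]
    onto [K + None].  Its two forms are the two possible positions of
    [phi None]: either [phi None = None] and [phi] maps [L] onto [K], or
    [phi None] is a point [p] of [K], necessarily isolated, and some point [t]
    of [L] is mapped to [None].

    The functionals of interest are the differences of two evaluations,
    [ext x c - ext x d].  Such a functional supports a face of the unit ball,
    the set of those [u] in the ball whose oscillation 1 is attained at
    [(c, d)], and it is the only linear functional equal to 1 on that face
    ([face_functional]).  An isometry maps the face of [(c, d)] to a convex
    part of the unit sphere; by compactness all elements of this part attain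
    their oscillation at a common pair [(a, b)], so that
    [ext (T x) a - ext (T x) b = ext x c - ext x d] for all [x]
    ([isometry_root]).  Applied to the inverse of [T], the same lemma expresses
    every difference of evaluations of [T x] by a difference of evaluations
    of [x].

    What remains is the combinatorics of a root system of type A.  For [t] in
    [L] write [T x t = ext x (c t) - ext x (d t)].  Since the difference of
    these functionals at two points [t] and [s] is again a difference of two
    evaluations, the pairs [(c t, d t)] and [(c s, d s)] share exactly one
    coordinate ([root_diff]).  Points of a grid that pairwise lie on a common
    row or column all lie on one line ([grid_line]): either [d] is constant, or
    [c] is constant, which is the case of the negative sign.  This gives the
    bijection [phi] ([isometry_pointed_form]); it is continuous in both
    directions because a compact Hausdorff space carries the weak topology of
    its continuous functions ([continuous_into_compact]).

    Finally, in the second form the image of the constant function 1 vanishes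
    exactly off [t], so that [t] is isolated; this excludes that form when
    there are no isolated points. *)

(** * Functions on a compact Hausdorff space *)

Section Separation.
Context {R : realType} {X : topologicalType}.
Hypotheses (cptX : compact [set: X]) (hausX : hausdorff_space X).

Lemma urysohn_point (p : X) (B : set X) : closed B -> ~ B p ->
  exists z : X -> R, [/\ continuous z, forall q, 0 <= z q <= 1, z p = 1 &
    forall q, B q -> z q = 0].
Proof.
move=> clB nBp.
have crX : completely_regular_space X.
  apply: (@normal_completely_regular R); first exact: compact_normal.
  exact: hausdorff_accessible.
have /(uniform_separatorP (R := R))[f [cf f01 f0 f1]] := crX p B clB nBp.
exists (fun q => 1 - f q); split.
- by move=> q; apply: cvgB; [exact: cvg_cst | exact: cf].
- move=> q; have /f01 : range f (f q) by exists q.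
  by rewrite /= in_itv /= => /andP[? ?]; apply/andP; split; lra.
- by rewrite (f0 (f p)) ?subr0 //; exists p.
- by move=> q Bq; rewrite (f1 (f q)) ?subrr //; exists q.
Qed.

Lemma urysohn_finite (p : X) (s : seq X) :
  exists z : X -> R, [/\ continuous z, forall q, 0 <= z q <= 1 &
    forall q, q \in s -> z q = (q == p)%:R].
Proof.
have /accessible_finite_set_closed clX := hausdorff_accessible hausX.
have [||z [cz z01 zp z0]] := @urysohn_point p [set` [seq q <- s | q != p]].
- by apply: clX; exact: finite_seq.
- by rewrite /= mem_filter eqxx.
- exists z; split=> // q qs; have [->//|qp] := eqVneq q p.
  by rewrite z0 //= mem_filter qp.
Qed.

(** Unlike in the metrizable case, [u] may take the values 1 and 0 at
    other points as well. *)
Definition peak (c d : X) (u : X -> R) :=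
  [/\ forall q, 0 <= u q <= 1, u c = 1 & u d = 0].

Lemma exists_peak (c d : X) : c != d ->
  exists2 w : X -> R, continuous w & peak c d w.
Proof.
move=> cd; have [w [cw w01 wE]] := urysohn_finite c [:: c; d].
exists w => //; split=> //; first by rewrite wE ?inE ?eqxx.
by rewrite wE ?inE ?eqxx ?orbT // eq_sym (negbTE cd).
Qed.

(** Peak functions for [(c, d)] span the continuous functions modulo
    constants.  Removing a multiple of one peak function [w] leaves a function
    [z0] that vanishes at [c] and [d]; after scaling, [`|z1| <= 1/2], and
    truncating [w] between [`|z1|] and [1 - `|z1|] yields a peak function [u]
    that remains one when [z1] is added. *)
Lemma peak_decomposition (c d : X) (x : X -> R) : c != d -> continuous x ->
  exists (B : R) (u v w : X -> R),
  [/\ continuous u /\ peak c d u, continuous v /\ peak c d v,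
      continuous w /\ peak c d w &
      forall q, x q - x d = B * (v q - u q) + (x c - x d) * w q].
Proof.
move=> cd cx.
have [w cw Pw] := exists_peak cd; have [w01 wc wd] := Pw.
set k := x c - x d; pose z0 q := x q - x d - k * w q.
have cz0 : continuous z0.
  move=> q; apply: cvgB; first by apply: cvgB; [exact: cx|exact: cvg_cst].
  by apply: cvgMr; exact: cw.
have cn0 : continuous (fun q => `|z0 q|).
  by move=> q; apply: cvg_norm; exact: cz0.
have [m _ zm] :=
  compact_EVT_max (ex_intro _ c I) cptX (continuous_subspaceT cn0).
(* The summand 1 keeps [B] positive when [z0] vanishes identically. *)
pose B := 2 * `|z0 m| + 1.
have B0 : 0 < B by rewrite ltr_wpDl // mulr_ge0.
pose z1 q := B^-1 * z0 q.
have cz1 : continuous z1 by move=> q; apply: cvgMr; exact: cz0.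
have cn1 : continuous (fun q => `|z1 q|).
  by move=> q; apply: cvg_norm; exact: cz1.
have z1_le q : `|z1 q| <= 2^-1.
  rewrite normrM gtr0_norm ?invr_gt0 // mulrC ler_pdivrMr //.
  have : `|z0 q| <= `|z0 m| by apply: zm; rewrite in_setT.
  by rewrite /B; lra.
have z1c : z1 c = 0 by rewrite /z1 /z0 wc -/k mulr1 subrr mulr0.
have z1d : z1 d = 0 by rewrite /z1 /z0 wd mulr0 !subrr mulr0.
pose u := (fun q => `|z1 q|) \max ((fun q => 1 - `|z1 q|) \min w).
have cu : continuous u.
  move=> q; apply: continuous_max; first exact: cn1.
  apply: continuous_min; last exact: cw.
  by apply: cvgB; [exact: cvg_cst|exact: cn1].
have u_le q : `|z1 q| <= u q <= 1 - `|z1 q|.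
  rewrite /u /= le_max lexx ge_max ge_min lexx /= andbT.
  by have := z1_le q; lra.
have uc : u c = 1 by rewrite /u /= z1c normr0 wc subr0 minxx max_r.
have ud : u d = 0 by rewrite /u /= z1d normr0 wd subr0 min_r // maxxx.
exists B, u, (fun q => z1 q + u q), w; split=> //.
- do 2!split=> //; move=> q; have /andP[? ?] := u_le q.
  by have ? := normr_ge0 (z1 q); apply/andP; split; lra.
- split; first by move=> q; apply: cvgD; [exact: cz1|exact: cu].
  split; rewrite ?z1c ?z1d ?uc ?ud ?add0r // => q.
  have /andP[? ?] := u_le q; have := ler_norm (z1 q); have := ler_norm (- z1 q).
  by rewrite normrN => ? ?; apply/andP; split; lra.
- by move=> q; rewrite addrK /z1 /z0 mulrA divff ?lt0r_neq0 // mul1r; ring.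
Qed.

(** The topology of a compact Hausdorff space is the weak topology of its
    continuous real functions. *)
Lemma continuous_into_compact (Z : topologicalType) (g : Z -> X) :
  (forall y : continuousType X R, continuous (y \o g)) -> continuous g.
Proof.
move=> wg u U /=; rewrite nbhsE => -[V [oV Vgu] VU].
have [||z [cz _ zp z0]] := @urysohn_point (g u) (~` V).
- exact: open_closedC.
- exact.
have pos_nbhs : nbhs (z (g u)) [set r | 0 < r].
  by apply: open_nbhs_nbhs; split; [exact: open_gt | rewrite /= zp].
have gV : nbhs u [set v | 0 < z (g v)] := wg (mkcts cz) u _ pos_nbhs.
rewrite nbhs_simpl; apply: filterS gV => v /= zv.
apply: VU; apply: contrapT => /z0 zv0.
by move: zv; rewrite /mkcts zv0 ltxx.
Qed.

End Separation.

(** * The diameter norm as an oscillation *)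

Lemma sup_max (R : realType) (A : set R) (m : R) :
  A m -> ubound A m -> sup A = m.
Proof.
move=> Am Ub; apply/le_anti/andP; split; first by apply: ge_sup => //; exists m.
by apply: ub_le_sup => //; exists m.
Qed.

(** For a compact space the added point is isolated, so that this is the
    topological sum of [K] and a point. *)
Notation pointed_sum K := (one_point_compactification K).

Section Extension.
Context {R : realType} {K : topologicalType}.

Definition ext (x : K -> R) (a : pointed_sum K) : R :=
  if a is Some t then x t else 0.

Hypotheses (cptK : compact [set: K]) (hausK : hausdorff_space K).

Lemma ext_continuous (x : continuousType K R) : continuous (ext x).
Proof.
move=> [t|].
  move=> U /= Uxt; exact: (@cts_fun _ _ x t U Uxt).
move=> U /nbhs_singleton U0.
by exists setT; [split=> //; exact: closedT | move=> _ [[? []]//|->]].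
Qed.

(** Left inverse of [ext] that ignores constants. *)
Definition restr (z : pointed_sum K -> R) (t : K) : R := z (Some t) - z None.

Lemma restr_continuous (z : pointed_sum K -> R) :
  continuous z -> continuous (restr z).
Proof.
move=> cz t; apply: cvgB; last exact: cvg_cst.
by move=> U /cz.
Qed.

Definition cts_restr z (cz : continuous z) : continuousType K R :=
  mkcts (restr_continuous cz).

Lemma ext_restr z (cz : continuous z) a : ext (cts_restr cz) a = z a - z None.
Proof. by case: a => [t//|] /=; rewrite subrr. Qed.

Lemma ext_linear (k : R) (x y : continuousType K R) a :
  ext (k *: x + y) a = k * ext x a + ext y a.
Proof. by case: a => [t//|] /=; rewrite mulr0 addr0. Qed.

Lemma pointed_sum_hausdorff : hausdorff_space (pointed_sum K).
Proof.
apply: one_point_compactification_hausdorff => // t _.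
rewrite withinET; exists setT; first exact: filterT.
by split=> //; exact: closedT.
Qed.

(** The maximum of [ext x] is nonnegative because of the value 0 at the added
    point; it is attained there alone when [x] is negative or [K] is empty. *)
Lemma pos_supnorm (x : K -> R) a :
  (forall c, ext x c <= ext x a) -> supnorm x^\+ = ext x a.
Proof.
move=> xa; have a0 : 0 <= ext x a := xa None.
have ub : ubound (range (fun t => `|x^\+ t|)) (ext x a).
  move=> _ [t _ <-]; rewrite ger0_norm; last by rewrite le_max lexx orbT.
  by rewrite /funrpos ge_max a0 andbT; exact: xa (Some t).
have [[t0]|K0] := pselect (inhabited K); last first.
  rewrite /supnorm; have -> : range (fun t => `|x^\+ t|) = set0.
    by rewrite -subset0 => r [t]; case: K0.
  rewrite sup0; case: a {xa a0 ub} => // t; by case: K0.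
apply: sup_max => //=; case: a xa a0 ub => [t|] xa a0 ub.
  by exists t => //; rewrite /funrpos max_l // ger0_norm.
exists t0 => //; rewrite /funrpos max_r ?normr0 //; exact: xa (Some t0).
Qed.

(** The uniform norms of the positive and negative parts of [x] are the maxima
    of [ext x] and of its opposite, attained by compactness. *)
Lemma dnorm_osc (x : continuousType K R) : exists a b,
  (forall c, ext x b <= ext x c <= ext x a) /\ dnorm x = ext x a - ext x b.
Proof.
have cM := @one_point_compactification_compact K.
have M0 : [set: pointed_sum K] !=set0 by exists None.
have cx := continuous_subspaceT (@ext_continuous x).
have [a _ xa] := compact_EVT_max M0 cM (cx _).
have [b _ xb] := compact_EVT_min M0 cM (cx _).
exists a, b; split=> [c|].
  by rewrite xa ?xb // in_setT.
have extN c : ext (\- x) c = - ext x c by case: c => //=; rewrite oppr0.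
rewrite /dnorm (@pos_supnorm x a); last by move=> c; rewrite xa ?in_setT.
rewrite -funrposN (@pos_supnorm _ b) ?extN // => c.
by rewrite !extN lerN2 xb ?in_setT.
Qed.

Lemma ext_dnorm_le (x : continuousType K R) a b : ext x a - ext x b <= dnorm x.
Proof.
have [c [d [xcd ->]]] := dnorm_osc x.
have /andP[_ ac] := xcd a; have /andP[db _] := xcd b; lra.
Qed.

(** * Faces of the unit ball *)

Definition face (c d : pointed_sum K) : set (continuousType K R) :=
  [set u | dnorm u <= 1 /\ ext u c - ext u d = 1].

Lemma face_cts_restr (z : pointed_sum K -> R) (cz : continuous z) c d :
  peak c d z -> face c d (cts_restr cz).
Proof.
move=> [z01 zc zd]; split; last by rewrite !ext_restr zc zd; lra.
have [a [b [_ ->]]] := dnorm_osc (cts_restr cz); rewrite !ext_restr.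
by have := z01 a; have := z01 b; lra.
Qed.

Lemma face_nonempty c d : c != d -> face c d !=set0.
Proof.
move=> cd; have [w cw Pw] := exists_peak
  (@one_point_compactification_compact K) pointed_sum_hausdorff cd (R := R).
by exists (cts_restr cw); exact: face_cts_restr.
Qed.

(** Since [ext x c - ext x d] also equals 1 on the face, uniqueness follows
    from the fact that the face spans C(K) ([peak_decomposition]). *)
Lemma face_functional (c d : pointed_sum K) (f : continuousType K R -> R) :
  c != d -> scalar f -> (forall u, face c d u -> f u = 1) ->
  forall x, f x = ext x c - ext x d.
Proof.
move=> cd fl f1 x.
have cM := @one_point_compactification_compact K.
have [B [u [v [w [[cu Pu] [cv Pv] [cw Pw] xE]]]]] :=
  peak_decomposition cM pointed_sum_hausdorff cd (@ext_continuous x).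
set k := ext x c - ext x d in xE *.
have -> : x = B *: (cts_restr cv - cts_restr cu) + k *: cts_restr cw.
  apply/continuousEP => t; rewrite -[LHS]subr0.
  have -> : x t - 0 = ext x (Some t) - ext x d - (ext x None - ext x d).
    by rewrite /=; ring.
  rewrite !xE -[RHS]/(B * (v (Some t) - v None - (u (Some t) - u None)) +
    k * (w (Some t) - w None)).
  by ring.
have f0 : f 0 = 0 by have := fl (-1) 0 0; rewrite scaleN1r oppr0 addr0; lra.
have fZ r y : f (r *: y) = r * f y by rewrite -[r *: y]addr0 fl f0 addr0.
have fB y z : f (y - z) = f y - f z.
  by rewrite -scaleN1r addrC fl mulN1r addrC.
by rewrite fl fZ fB !f1 ?subrr ?mulr0 ?add0r ?mulr1 //; exact: face_cts_restr.
Qed.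

Lemma ext_midpoint (u v : continuousType K R) a :
  ext (2^-1 *: (u + v)) a = (ext u a + ext v a) / 2.
Proof. by case: a => [t|] /=; [rewrite mulrC | rewrite addr0 mul0r]. Qed.

Lemma face_midpoint c d u v : face c d u -> face c d v ->
  face c d (2^-1 *: (u + v)).
Proof.
move=> [nu Fu] [nv Fv]; split; last by rewrite !ext_midpoint; lra.
have [a [b [_ ->]]] := dnorm_osc (2^-1 *: (u + v)); rewrite !ext_midpoint.
by have := ext_dnorm_le u a b; have := ext_dnorm_le v a b; lra.
Qed.

(** * Differences of two evaluations *)

(** The constant [r] is the price of the normalization [ext x None = 0]; it
    disappears in differences of evaluations. *)
Lemma ext_indicator (p : pointed_sum K) (s : seq (pointed_sum K)) :
  exists x : continuousType K R, exists r, forall q, q \in s ->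
    ext x q = (q == p)%:R - r.
Proof.
have [z [cz _ zE]] := urysohn_finite (@one_point_compactification_compact K)
  pointed_sum_hausdorff p s (R := R).
by exists (cts_restr cz), (z None) => q qs; rewrite ext_restr zE.
Qed.

(** Testing on indicators makes this an identity between formal sums of
    points.  If no coordinate is shared, then [c1] can only cancel against [c],
    and [d1] against [d], which leaves [c2 = d2]; if both are shared, then
    [c = d].  Either way a hypothesis is contradicted. *)
Lemma root_diff (c1 d1 c2 d2 c d : pointed_sum K) :
  c1 != d1 -> c2 != d2 -> c != d ->
  (forall x : continuousType K R,
    ext x c1 - ext x d1 - (ext x c2 - ext x d2) = ext x c - ext x d) ->
  (c1 == c2) (+) (d1 == d2).
Proof.
move=> cd1 cd2 cd E.
have I p : (c1 == p)%:R - (d1 == p)%:R - ((c2 == p)%:R - (d2 == p)%:R) =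
    (c == p)%:R - (d == p)%:R :> R.
  have [x [r xE]] := ext_indicator p [:: c1; d1; c2; d2; c; d].
  by have := E x; rewrite !xE ?inE ?eqxx ?orbT //; lra.
have [ec|nc] := eqVneq c1 c2; have [ed|nd] := eqVneq d1 d2 => //=; exfalso.
  by have := I c; rewrite ec ed eqxx (eq_sym d) (negbTE cd) /=; lra.
have Ec := I c1; have Ed := I d1; have Ec2 := I c2.
move: Ec Ed Ec2; rewrite !eqxx (eq_sym d1 c1) (negbTE cd1).
rewrite (eq_sym c2 c1) (negbTE nc).
rewrite (eq_sym d2 d1) (negbTE nd) (eq_sym d2 c2) (negbTE cd2).
have [->|_] := eqVneq c c1; last first.
  by case: (d2 == c1); case: (d == c1) => /=; lra.
have [->|_] := eqVneq d d1; last first.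
  by case: (c2 == d1); case: (c1 == d1) => /=; lra.
by rewrite (negbTE nc) (eq_sym d1 c2); case: (c2 == d1) => /=; lra.
Qed.

End Extension.

(** If [t] and [s] differ in the second coordinate, they lie on one line [l]
    of constant first coordinate.  A point [u] cannot agree in the second
    coordinate with both of them, hence it lies on [l]. *)
Lemma grid_line (I : eqType) (P Q : eqType) (g : I -> P * Q) :
  (forall t s, t != s -> ((g t).1 == (g s).1) (+) ((g t).2 == (g s).2)) ->
  (forall t s, (g t).1 = (g s).1) \/ (forall t s, (g t).2 = (g s).2).
Proof.
move=> gP; have [|/existsNP[t /existsNP[s /eqP ts]]] :=
  pselect (forall t s, (g t).2 = (g s).2); first by right.
have share u v : (g u).2 != (g v).2 -> (g u).1 = (g v).1.
  move=> uv; have /gP : u != v by apply: contraNneq uv => ->.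
  by rewrite (negbTE uv) addbF => /eqP.
suff all_t u : (g u).1 = (g t).1 by left=> u v; rewrite !all_t.
have [ut|/share//] := eqVneq (g u).2 (g t).2.
by rewrite (share t s ts); apply: share; rewrite ut.
Qed.

(** * Isometries up to constants *)

Section Isometry.
Context {R : realType} {K L : topologicalType}.
Hypotheses (cptK : compact [set: K]) (hausK : hausdorff_space K).
Hypotheses (cptL : compact [set: L]) (hausL : hausdorff_space L).

(** The sets [A u] of pairs at which [T u] attains its oscillation, for [u] in
    the face of [(c, d)], are closed and nonempty.  They are directed
    downwards: where the midpoint of [T u] and [T v] attains oscillation 1, so
    do both [T u] and [T v].  A cluster point [(a, b)] of this family thus lies
    in all of them, and [face_functional] applies. *)
Lemma isometry_root (T : {linear continuousType K R -> continuousType L R}) :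
  (forall x, dnorm (T x) = dnorm x) ->
  forall c d : pointed_sum K, c != d -> exists a b : pointed_sum L,
    a != b /\ forall x, ext (T x) a - ext (T x) b = ext x c - ext x d.
Proof.
move=> isoT c d cd.
pose A (u : continuousType K R) : set (pointed_sum L * pointed_sum L) :=
  [set ab | ext (T u) ab.1 - ext (T u) ab.2 = 1].
have A0 u : face c d u -> A u !=set0.
  move=> [nu Fu]; have [a [b [_ E]]] := dnorm_osc cptL (T u).
  exists (a, b); rewrite /A /= -E isoT; apply/le_anti.
  by rewrite nu -Fu ext_dnorm_le.
have AI u v : face c d u -> face c d v -> 
    A (2^-1 *: (u + v)) `<=` A u `&` A v.
  move=> [nu _] [nv _] [a b] /=; rewrite /A /=.
  have := ext_dnorm_le cptL (T u) a b; have := ext_dnorm_le cptL (T v) a b.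
  rewrite !isoT linearZ linearD /= !ext_midpoint.
  by move=> ? ? ?; split; lra.
have FF : ProperFilter (filter_from (face c d) A).
  apply: filter_from_proper => //; apply: filter_from_filter.
    exact: face_nonempty.
  move=> u v Fu Fv; exists (2^-1 *: (u + v)); first exact: face_midpoint.
  exact: AI.
have cM := @one_point_compactification_compact L.
have [|[a b] [_ clab]] := compact_setX cM cM FF.
  by have [u Fu] := face_nonempty cptK hausK cd (R := R); exists u.
have Aab u : face c d u -> ext (T u) a - ext (T u) b = 1.
  move=> Fu.
  have clA : closed (A u).
    have cTu := ext_continuous cptL (x := T u).
    have cA : continuous (fun ab : pointed_sum L * pointed_sum L =>
        ext (T u) ab.1 - ext (T u) ab.2).
      move=> ab.
      apply: (@continuousB _ _ _ (ext (T u) \o fst) (ext (T u) \o snd)).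
        by apply: continuous_comp; [exact: cvg_fst|exact: cTu].
      by apply: continuous_comp; [exact: cvg_snd|exact: cTu].
    apply: (@preimage_closed _ _ _ [set r : R | r = 1]); last exact: closed_eq.
    by move=> ab _; exact: cA.
  apply: (clA (a, b)) => B Bab; apply: (clab (A u) B _ Bab); by exists u.
have E := @face_functional _ _ cptK hausK c d
  (fun x => ext (T x) a - ext (T x) b) cd.
have fE x : ext (T x) a - ext (T x) b = ext x c - ext x d.
  apply: E => // r u v; rewrite linearP !ext_linear /=; ring.
exists a, b; split => //; apply/eqP => ab.
have [u [_ Fu]] := face_nonempty cptK hausK cd (R := R).
by have := fE u; rewrite Fu ab; lra.
Qed.

End Isometry.

Section IsometryForm.
Context {R : realType} {K L : topologicalType}.
Hypotheses (cptK : compact [set: K]) (hausK : hausdorff_space K).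
Hypotheses (cptL : compact [set: L]) (hausL : hausdorff_space L).

(** Every isometry comes from a bijection [phi] of the enlarged spaces.  The
    inverse [S] provides the representation [T x t = ext x c - ext x d], from
    which [phi] is read off, while [isometry_root] for [T] itself shows that
    [phi] is surjective: a pair [(p, phi None)] must be reached. *)
Lemma isometry_pointed_form
    (T : {linear continuousType K R -> continuousType L R})
    (S : {linear continuousType L R -> continuousType K R}) :
  (forall x, dnorm (T x) = dnorm x) -> cancel S T -> cancel T S ->
  exists (e : bool) (phi : pointed_sum L -> pointed_sum K)
         (psi : pointed_sum K -> pointed_sum L),
    [/\ cancel phi psi, cancel psi phi &
      forall x a, ext (T x) a = (-1) ^+ e * (ext x (phi a) - ext x (phi None))].
Proof.
move=> isoT ST TS.
have isoS y : dnorm (S y) = dnorm y by rewrite -isoT ST.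
have root a b : a != b -> exists cd : pointed_sum K * pointed_sum K,
    cd.1 != cd.2 /\
    forall x, ext (T x) a - ext (T x) b = ext x cd.1 - ext x cd.2.
  move=> ab; have [c [d [cd E]]] := isometry_root cptL hausL cptK isoS ab.
  by exists (c, d); split=> // x; rewrite -E TS.
have /choice[g gP] (t : L) := root (Some t) None isT.
have gT x t : T x t = ext x (g t).1 - ext x (g t).2.
  by have [_ <-] := gP t; rewrite /= subr0.
have gneq t : (g t).1 != (g t).2 by have [] := gP t.
have gshare t s : t != s -> ((g t).1 == (g s).1) (+) ((g t).2 == (g s).2).
  move=> ts; have [|[c d] [cd E]] := root (Some t) (Some s).
    by apply: contraNneq ts => -[->].
  by apply: (root_diff cptK hausK (gneq t) (gneq s) cd (R := R)) => x;
     rewrite -E /= !gT.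
have [e [q [h [hq hinj hT]]]] : exists (e : bool) q (h : L -> pointed_sum K),
    [/\ forall t, h t != q, injective h &
      forall x t, T x t = (-1) ^+ e * (ext x (h t) - ext x q)].
  have [[t0]|L0] := pselect (inhabited L); last first.
    by exists false, None, (fun=> None); split=> [t|t|x t];
      case: (L0 (inhabits t)).
  have [g1|g2] := grid_line gshare.
    (* A common first coordinate is the base point with a negative sign. *)
    exists true, (g t0).1, (fun t => (g t).2); split=> [t|t s|x t].
    - by rewrite (g1 t0 t) eq_sym.
    - move=> ts; apply/eqP; apply: contraT => /gshare.
      by rewrite ts (g1 t s) !eqxx.
    - by rewrite (g1 t0 t) gT expr1 mulN1r opprB.
  exists false, (g t0).2, (fun t => (g t).1); split=> [t|t s|x t].
  - by rewrite (g2 t0 t).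
  - move=> ts; apply/eqP; apply: contraT => /gshare.
    by rewrite ts (g2 t s) !eqxx.
  - by rewrite (g2 t0 t) gT expr0 mul1r.
pose phi (a : pointed_sum L) := if a is Some t then h t else q.
have phiT x a : ext (T x) a = (-1) ^+ e * (ext x (phi a) - ext x q).
  by case: a => [t|] /=; rewrite ?hT // subrr mulr0.
have phi_inj : injective phi.
  move=> [t|] [s|] //=; first by move/hinj->.
    by move/eqP; rewrite (negbTE (hq t)).
  by move/eqP; rewrite eq_sym (negbTE (hq s)).
have /choice[psi psiK] p : exists a, phi a = p.
  have [->|pq] := eqVneq p q; first by exists None.
  have [a [b [_ E]]] := isometry_root cptK hausK cptL isoT pq.
  have [x [r xE]] :=
    ext_indicator cptK hausK p [:: p; q; phi a; phi b] (R := R).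
  have := E x; rewrite !phiT !xE ?inE ?eqxx ?orbT // (eq_sym q) (negbTE pq) /=.
  have [<- _|_] := eqVneq (phi a) p; first by exists a.
  have [<- _|_] := eqVneq (phi b) p; first by exists b.
  by move=> H; exfalso; move: H; case: (e); rewrite ?expr0 ?expr1 /=; lra.
by exists e, phi, psi; split=> // a; apply: phi_inj; rewrite psiK.
Qed.

End IsometryForm.
(** * The two forms of an isometry *)

Lemma continuous_affine (R : realType) (Z : topologicalType) (y : Z -> R)
    (a b : R) :
  continuous y -> continuous (fun z => a + b * y z).
Proof.
by move=> cy z; apply: cvgD; [exact: cvg_cst|apply: cvgMr; exact: cy].
Qed.

Definition composition_form {R : realType} {K L : topologicalType}
    (T : continuousType K R -> continuousType L R) (e : bool) :=
  exists phi : L -> K, homeomorphism phi /\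
    forall x s, T x s = (-1) ^+ e * x (phi s).

Definition exchange_form {R : realType} {K L : topologicalType}
    (T : continuousType K R -> continuousType L R) (e : bool) (p : K) (t : L) :=
  exists phi : set_type [set~ t] -> set_type [set~ p],
    [/\ homeomorphism phi, forall x, T x t = (-1) ^+ e * x p &
      forall x s, T x (set_val s) = (-1) ^+ e * (x p - x (set_val (phi s)))].

Section Classification.
Context {R : realType} {K L : topologicalType}.
Hypotheses (cptK : compact [set: K]) (hausK : hausdorff_space K).
Hypotheses (cptL : compact [set: L]) (hausL : hausdorff_space L).
Variables (T : {linear continuousType K R -> continuousType L R}) (e : bool).
Hypothesis surjT : forall y, exists x, T x = y.
Variables (phi : pointed_sum L -> pointed_sum K)
  (psi : pointed_sum K -> pointed_sum L).
Hypotheses (phiK : cancel phi psi) (psiK : cancel psi phi).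
Hypothesis phiT : forall x a,
  ext (T x) a = (-1) ^+ e * (ext x (phi a) - ext x (phi None)).

Lemma base_fixed_form : phi None = None -> composition_form T e.
Proof.
move=> phi0; have psi0 : psi None = None by rewrite -phi0 phiK.
have /choice[f fE] s : exists r, phi (Some s) = Some r.
  case E: (phi (Some s)) => [r|]; first by exists r.
  by have := phiK (Some s); rewrite E psi0.
have /choice[g gE] r : exists s, psi (Some r) = Some s.
  case E: (psi (Some r)) => [s|]; first by exists s.
  by have := psiK (Some r); rewrite E phi0.
have fT x s : T x s = (-1) ^+ e * x (f s).
  by have := phiT x (Some s); rewrite phi0 fE /= subr0.
have fK : cancel f g by move=> s; have := phiK (Some s); rewrite fE gE => -[].
have gK : cancel g f by move=> r; have := psiK (Some r); rewrite gE fE => -[].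
exists f; split=> //; split.
  apply: (continuous_into_compact (R := R) cptK hausK) => y.
  rewrite (_ : y \o f = fun s => 0 + (-1) ^+ e * T y s).
    by apply: continuous_affine; exact: cts_fun.
  by apply/funext => s /=; rewrite add0r fT mulrA -expr2 sqrr_sign mul1r.
exists g; split=> //.
apply: (continuous_into_compact (R := R) cptL hausL) => y.
have [x <-] := surjT y.
rewrite (_ : T x \o g = fun r => 0 + (-1) ^+ e * x r).
  by apply: continuous_affine; exact: cts_fun.
by apply/funext => r /=; rewrite add0r fT gK.
Qed.

(** The sign changes because the base point is now [p]:
    [ext x (phi s) - x p] is the opposite of [x p - x (phi s)], and at the
    point [t] that [phi] sends to [None] the first term vanishes. *)
Lemma base_moved_form (p : K) : phi None = Some p ->
  exists t : L, exchange_form T (~~ e) p t.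
Proof.
move=> phi0; have [t psi0] : exists t, psi None = Some t.
  case E: (psi None) => [t|]; first by exists t.
  by have := psiK None; rewrite E phi0.
have signC (r : R) : (-1) ^+ e * r = (-1) ^+ (~~ e) * - r.
  by case: (e); rewrite !(expr0, expr1) ?mulN1r ?mul1r ?opprK.
have /choice[f fE] (s : set_type [set~ t]) : exists r : set_type [set~ p],
    phi (Some (set_val s)) = Some (set_val r).
  have sK := phiK (Some (set_val s)).
  case E: (phi _) sK => [r|]; last first.
    by rewrite psi0 => -[ts]; case: (set_valP s).
  move=> sK; have rp : r \in [set~ p].
    by apply/mem_set => /= rp; have := phiK None; rewrite phi0 -rp sK.
  by exists (SigSub rp).
have /choice[g gE] (r : set_type [set~ p]) : exists s : set_type [set~ t],
    psi (Some (set_val r)) = Some (set_val s).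
  have rK := psiK (Some (set_val r)).
  case E: (psi _) rK => [s|]; last first.
    by rewrite phi0 => -[pr]; case: (set_valP r).
  move=> rK; have st : s \in [set~ t].
    by apply/mem_set => /= st; have := psiK None; rewrite psi0 -st rK.
  by exists (SigSub st).
have fT x s : T x (set_val s) = (-1) ^+ (~~ e) * (x p - x (set_val (f s))).
  by have := phiT x (Some (set_val s)); rewrite phi0 fE /= signC opprB.
have fK : cancel f g.
  move=> s; have := phiK (Some (set_val s)); rewrite fE gE => -[].
  exact: val_inj.
have gK : cancel g f.
  move=> r; have := psiK (Some (set_val r)); rewrite gE fE => -[].
  exact: val_inj.
exists t, f; split=> //; last first.
  move=> x; have := phiT x (Some t).
  by rewrite -psi0 psiK phi0 psi0 /= sub0r signC opprK.
split.
  apply: continuous_comp_initial.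
  apply: (continuous_into_compact (R := R) cptK hausK) => y.
  rewrite (_ : y \o _ = fun s => y p + - (-1) ^+ (~~ e) * (T y \o set_val) s).
    apply: continuous_affine => s; apply: continuous_comp; last exact: cts_fun.
    exact: initial_continuous.
  apply/funext => s /=; rewrite fT mulrA mulNr -expr2 sqrr_sign; ring.
exists g; split=> //.
apply: continuous_comp_initial.
apply: (continuous_into_compact (R := R) cptL hausL) => y.
have [x <-] := surjT y.
rewrite (_ : T x \o _ = fun r => (-1) ^+ (~~ e) * x p +
    - (-1) ^+ (~~ e) * (x \o set_val) r).
  apply: continuous_affine => r; apply: continuous_comp; last exact: cts_fun.
  exact: initial_continuous.
by apply/funext => r /=; rewrite fT gK; ring.
Qed.

End Classification.

Lemma isometry_injective (R : realType) (K L : topologicalType)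
    (T : {linear continuousType K R -> continuousType L R}) :
  compact [set: K] -> (forall x, dnorm (T x) = dnorm x) -> injective T.
Proof.
move=> cptK isoT x y Txy; apply/eqP; rewrite -subr_eq0; apply/eqP.
have [a [b [zab E]]] := dnorm_osc cptK (x - y).
have [a' [b' [zab' E']]] := dnorm_osc cptK (0 : continuousType K R).
have z0 : dnorm (x - y) = 0.
  rewrite -isoT linearB Txy subrr -(linear0 T) isoT E'.
  by case: a' {zab' E'} => [?|]; case: b' => [?|]; rewrite /= subr0.
apply/continuousEP => t; rewrite -[LHS]/(ext (x - y) (Some t)).
rewrite -[RHS]/(ext (x - y) None); rewrite E in z0.
have /andP[? ?] := zab (Some t); have /andP[? ?] := zab None.
by apply/le_anti/andP; split; lra.
Qed.

Lemma isometry_classification (R : realType) (K L : topologicalType)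
    (T : {linear continuousType K R -> continuousType L R}) :
  compact [set: K] -> hausdorff_space K ->
  compact [set: L] -> hausdorff_space L -> isometric_isomorphism T ->
  (exists e, composition_form T e) \/
  (exists e p t, exchange_form T e p t).
Proof.
move=> cptK hausK cptL hausL [surjT isoT].
have injT := isometry_injective cptK isoT.
have [S ST] := choice surjT.
have TS : cancel T S by move=> x; apply: injT; rewrite ST.
pose Slin := GRing.isLinear.Build _ _ _ _ S (can2_linear TS ST).
pose S' : {linear continuousType L R -> continuousType K R} := HB.pack S Slin.
have [e [phi [psi [phiK psiK phiT]]]] :=
  isometry_pointed_form cptK hausK cptL hausL (S := S') isoT ST TS.
case phi0: (phi None) => [p|].
  right; exists (~~ e), p.
  exact: (base_moved_form cptK hausK cptL hausL surjT phiK psiK phiT phi0).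
left; exists e.
exact: (base_fixed_form cptK hausK cptL hausL surjT phiK psiK phiT phi0).
Qed.

(** The image of the constant function 1 is nonzero at [t] only. *)
Lemma exchange_form_isolated (R : realType) (K L : topologicalType)
    (T : continuousType K R -> continuousType L R) (e : bool) (p : K) (t : L) :
  exchange_form T e p t -> isolated [set: L] t.
Proof.
move=> [phi [_ Tt Ts]]; split; first exact: in_setT.
have c1 : continuous (fun _ : K => 1 : R) by move=> ?; exact: cvg_cst.
pose y := T (mkcts c1).
have yt : y t != 0 by rewrite /y Tt mulr1 signr_eq0.
exists [set s | y s != 0].
  apply: (@cts_fun _ _ y t [set r | r != 0]).
  by apply: open_nbhs_nbhs; split=> //; exact: open_neq.
rewrite setIT; apply/seteqP; split=> [s /= ys|_ ->//].
apply: contrapT => st; have st' : s \in [set~ t] by apply/mem_set.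
by move: ys; rewrite /y (Ts _ (SigSub st')) subrr mulr0 eqxx.
Qed.

Theorem theorem8 (R : realType) (K L : topologicalType)
    (cptK : compact [set: K]) (hausK : hausdorff_space K)
    (cptL : compact [set: L]) (hausL : hausdorff_space L) :
  (isolated [set: K] = set0 -> isolated [set: L] = set0 ->
   forall T : {linear continuousType K R -> continuousType L R},
   isometric_isomorphism T ->
   exists (e : bool) (phi : L -> K),
     homeomorphism phi /\ forall (x : continuousType K R) (s : L), T x s = (-1) ^+ e * x (phi s))
  /\
  (isolated [set: K] !=set0 \/ isolated [set: L] !=set0 ->
   forall T : {linear continuousType K R -> continuousType L R},
   isometric_isomorphism T ->
   (exists (e : bool) (phi : L -> K),
      homeomorphism phi /\ forall (x : continuousType K R) (s : L), T x s = (-1) ^+ e * x (phi s))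
   \/
   (exists (e : bool) (p : K) (t : L)
           (phi : set_type [set~ t] -> set_type [set~ p]),
      [/\ homeomorphism phi,
          forall x : continuousType K R, T x t = (-1) ^+ e * x p &
          forall (x : continuousType K R) (s : set_type [set~ t]),
            T x (set_val s) = (-1) ^+ e * (x p - x (set_val (phi s)))])).
Proof.
split=> [_ L0 T isoT|_ T isoT]; last exact: isometry_classification.
have [//|[e [p [t /exchange_form_isolated]]]] :=
  isometry_classification cptK hausK cptL hausL isoT.
by rewrite L0.
Qed.
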